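(* Let $d\ge2$, $\Omega=[-1/2,1/2]^d$, and let $f:\mathbb{R}^d\to\mathbb{C}$ be a measurable function with support included in $\Omega$. Let $\gamma>0$ and let $(\delta_n)$ be a sequence of positive numbers with $\delta_n\to0$ and $\lim_n\delta_n^d n=\gamma$. Let $X_1,\dots,X_n$ be independent points uniformly distributed on $\Omega$, and let $\lambda'_1(n),\dots,\lambda'_n(n)$ be the eigenvalues of $B_n=(f_{\delta_n}(X_i-X_j))_{1\le i,j\le n}$, where $f_\delta(x)=f(x/\delta)$. Let $Po(\gamma)$ denote a random variable with Poisson distribution of intensity $\gamma$, and let the integer $j(n)$ be the solution of $$n\,\mathbb{P}(Po(\gamma)\ge j(n)+1)\le1<n\,\mathbb{P}(Po(\gamma)\ge j(n)).$$ Then with a probability tending to $1$ as $n$ goes to infinity, $$\max_{1\le i\le n}|\lambda_i'(n)|\le j(n)\sup_{x\in\Omega}|f(x)|.$$ *)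

(* Defs.v *)
From HB Require Import structures.
From mathcomp Require Import all_boot all_order all_algebra.
From mathcomp Require Import all_classical all_reals all_analysis.
From mathcomp Require Import complex.
Set Implicit Arguments.
Unset Strict Implicit.
Unset Printing Implicit Defensive.
Import Order.TTheory GRing.Theory Num.Theory.
Import numFieldNormedType.Exports.

Local Open Scope classical_set_scope.
Local Open Scope ring_scope.

Definition measure_rV_display : measure_display -> measure_display.
Proof. exact. Qed.

(* Row vectors carry the product sigma-algebra, generated by the coordinates;
   for T = R this is the Borel sigma-algebra of R^n. *)
Section measurable_rV.
Context {d} {T : sigmaRingType d}.
Variable n : nat.

Let coors : 'I_n -> 'rV[T]_n -> T := fun i x => x ord0 i.

Let rV_set0 : g_sigma_preimage coors set0.
Proof. exact: sigma_algebra0. Qed.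

Let rV_setC A : g_sigma_preimage coors A -> g_sigma_preimage coors (~` A).
Proof. exact: sigma_algebraC. Qed.

Let rV_bigcup (F : _^nat) : (forall i, g_sigma_preimage coors (F i)) ->
  g_sigma_preimage coors (\bigcup_i (F i)).
Proof. exact: sigma_algebra_bigcup. Qed.

HB.instance Definition _ := @isMeasurable.Build (measure_rV_display d)
  'rV[T]_n (g_sigma_preimage coors) rV_set0 rV_setC rV_bigcup.

End measurable_rV.

(* The d-dimensional Lebesgue measure, as an iterated product measure: the
   successor case is the product of lebesgue_measure with the measure in
   dimension d, written as the integral of the measures of the sections.  It is
   only meaningful on measurable sets. *)
Fixpoint lebesgue_rV (R : realType) (d : nat) : set 'rV[R]_d -> \bar R :=
  match d with
  | 0 => fun A => \d_(0 : 'rV[R]_0) A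
  | d'.+1 => fun A => (\int[lebesgue_measure]_x
      lebesgue_rV [set y : 'rV[R]_d' | A (row_mx (x%:M : 'rV[R]_1) y)])%E
  end.

Definition Omega (R : realType) (d : nat) : set 'rV[R]_d :=
  [set x | forall k, - 2^-1 <= x ord0 k <= 2^-1].

Definition uniformly_distributed (R : realType) (d : nat)
    (disp : measure_display) (T : measurableType disp) (P : probability T R)
    (X : {RV P >-> 'rV[R]_d}) (D : set 'rV[R]_d) : Prop :=
  forall A : set 'rV[R]_d, measurable A ->
    distribution P X A =
      (((fine (lebesgue_rV D))^-1)%:E * lebesgue_rV (A `&` D))%E.

(* Joint independence of a finite family; the product rule for a subfamily is
   the case where the other sets are setT. *)
Definition independent_RVs (R : realType) (n : nat)
    (disp disp' : measure_display) (T : measurableType disp)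
    (T' : measurableType disp') (P : probability T R)
    (X : 'I_n -> {RV P >-> T'}) : Prop :=
  forall A : 'I_n -> set T', (forall i, measurable (A i)) ->
    P [set w | forall i, A i (X i w)] = (\prod_(i < n) P (X i @^-1` A i))%E.

Definition complex_measurable (R : realType) (disp : measure_display)
    (T : measurableType disp) (f : T -> R[i]) : Prop :=
  measurable_fun setT (fun x => complex.Re (f x)) /\
  measurable_fun setT (fun x => complex.Im (f x)).

(* The Poisson law on nat; poisson_prob ignores its second argument. *)
Definition Po (R : realType) (gamma : R) : probability nat R :=
  poisson_prob gamma 0.

Definition rescale (R : realType) (d : nat) (f : 'rV[R]_d -> R[i]) (delta : R) :
    'rV[R]_d -> R[i] :=
  fun x => f (delta^-1 *: x).

Definition euclidean_matrix (R : realType) (d n : nat) (F : 'rV[R]_d -> R[i])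
    (x : 'I_n -> 'rV[R]_d) : 'M[R[i]]_n :=
  \matrix_(i < n, j < n) F (x i - x j).

(* The eigenvalues, listed with algebraic multiplicity in some order. *)
Definition eigenvalues_of (R : realType) (n : nat) (A : 'M[R[i]]_n)
    (lam : 'I_n -> R[i]) : Prop :=
  char_poly A = \prod_(i < n) ('X - (lam i)%:P).

(* Main.v *)
Require Import Defs.
From HB Require Import structures.
From mathcomp Require Import all_boot all_order all_algebra.
From mathcomp Require Import all_classical all_reals all_analysis.
From mathcomp Require Import complex.
From mathcomp Require Import measurable_realfun ring lra zify.
Import Order.TTheory GRing.Theory Num.Theory.
Import numFieldNormedType.Exports.
Local Open Scope classical_set_scope.
Local Open Scope ring_scope.

(** The eigenvalues are controlled by the number of points in cubes of side
    delta = delta_n.  Let S be the supremum of |f|, k = j(n), and call p and q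
    adjacent when X_p and X_q differ by at most delta/2 in every coordinate, so
    that the (q, p) entry vanishes unless p and q are adjacent.  If lambda is an
    eigenvalue with |lambda| > k S and v an eigenvector, then u = |v| satisfies
    k u_p <= sum of u_q over the q adjacent to p, for every p.

    Comparing with the largest row sum is not enough: the expected number of
    points whose cube contains j(n) further points is about
    n P(Po(gamma) >= j(n)), which exceeds 1, so rows with j(n) + 1 nonzero
    entries are to be expected.  What saves the bound is that such a row
    belongs to a large eigenvalue only if the points around it are clustered much
    more tightly than in a typical cube.  Let i maximise u.  Then i has at least k
    neighbours.  If the doubled cube around X_i contains fewer than k + e points, e
    being a small fraction of k, then almost all the neighbours a of i have u_a
    close to u_i, hence have about k neighbours themselves, and these are nearly
    the same points as the neighbours of i.  Now either such an a lies in the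
    lower quarter of the cube of X_i in a chosen coordinate, and then almost all
    the neighbours of i avoid the upper quarter, or almost all of them avoid the
    lower quarter.  In all cases (overloaded_neighbourhood) one of the following
    holds: some doubled cube has at least k + e points, or some cube has at least
    k points and three quarters of it contain almost k of them.

    Both configurations are unlikely, by the first moment method
    (first_moment_clusters).  To have only events that are products over the
    points, the positions are rounded to a grid of mesh h = delta/(4L), with L a
    large constant, and one sums over the at most const * n grid cells
    (cluster_event); rounding multiplies volumes by a factor close to 1.  By the
    choice of j(n), n gamma^k/k! is at most const * (k + 1).  The extra e points
    of the first configuration bring a factor C^k/k^e, and the confinement of
    the second one a factor (3/4)^k up to a correction with base close to 1
    (cluster_bound_le).  Both tend to 0 because j(n) tends to infinity
    (threshold_diverges).

    The event in the theorem must moreover be measurable, although the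
    enumeration of the eigenvalues is arbitrary.  It is a countable intersection
    of conditions on the characteristic polynomial at points with rational real
    and imaginary parts (roots_in_disc). *)

(** * A clustering dichotomy for large spectral radius *)

Section Overloaded.
Context {R : realFieldType} {I : finType}.
Variables (N N2 Qp Qm : I -> {set I}).

(** Here N i stands for the neighbours of i, N2 i for the points of the doubled
    cube, Qp i and Qm i for two overlapping parts of the cube of i such that a
    neighbour a of i outside Qp i pushes N a into Qm i.  The parameter 1/t is the
    relative loss u_i - u_a that a good neighbour a of a maximiser i may have; at
    most t e neighbours are bad, and the condition on k ensures that N a
    and N i still have k - t e points in common. *)
Lemma overloaded_neighbourhood (u : I -> R) (k e t : nat) :
  (forall i, i \in N i) ->
  (forall i p, p \in N i -> N p \subset N2 i) ->
  (forall i a, a \in N i -> a \in Qp i \/ N a :&: N i \subset Qm i) ->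
  (0 < t)%N -> (k <= t * (t - 1) * e)%N ->
  (forall i, 0 <= u i) -> (exists i, 0 < u i) ->
  (forall p, k%:R * u p <= \sum_(q in N p) u q) ->
  exists i, (k + e <= #|N2 i|)%N \/
    ((k <= #|N i|)%N /\
     ((k - t * e <= #|N i :&: Qp i|)%N \/ (k - t * e <= #|N i :&: Qm i|)%N)).
Proof.
move=> Nrefl NN2 Nsides t0 kte u0 [i0 ui0] uk.
have [i _ imax] : exists2 i, true & forall p, u p <= u i.
  by case: (@arg_maxP _ _ _ i0 xpredT u) => // i _ h; exists i => // p; exact: h.
have ui : 0 < u i by apply: lt_le_trans (imax i0).
have sumle p : \sum_(q in N p) u q <= #|N p|%:R * u i.
  rewrite mulr_natl -sumr_const; apply: ler_sum => q _; exact: imax.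
have kN : (k <= #|N i|)%N.
  by rewrite -(ler_nat R) -(ler_pM2r ui) (le_trans (uk i)).
exists i; case: (leqP (k + e) #|N2 i|) => [|ltN2]; [by left | right; split=> //].
have NiN2 : N i \subset N2 i by exact: NN2.
pose bad := [set p in N i | u i < t%:R * (u i - u p)].
(* the total loss of the neighbours is at most (|N i| - k) u_i <= e u_i, and a
   bad one loses more than u_i / t *)
have badle : (#|bad| <= t * e)%N.
  rewrite -(ler_nat R) -(ler_pM2r ui).
  have : \sum_(p in bad) u i <= \sum_(p in N i) t%:R * (u i - u p).
    rewrite [leRHS](bigID (mem bad)) /=.
    rewrite -[leLHS]addr0; apply: lerD.
      rewrite [leRHS](eq_bigl (mem bad)).
        by apply: ler_sum => p; rewrite inE => /andP[_ /ltW].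
      by move=> p; rewrite /= inE; case: (p \in N i).
    by apply: sumr_ge0 => p _; rewrite mulr_ge0 ?ler0n ?subr_ge0 ?imax.
  rewrite sumr_const => h; rewrite mulr_natl; apply: le_trans h _.
  rewrite -mulr_sumr natrM -mulrA; apply: ler_wpM2l; first exact: ler0n.
  rewrite sumrB sumr_const -[_ *+ #|_|]mulr_natl.
  rewrite lerBlDr; apply: le_trans (lerD (lexx _) (uk i)).
  rewrite -mulrDl; apply: ler_wpM2r; first exact: ltW.
  rewrite -natrD ler_nat; apply: leq_trans (subset_leq_card NiN2) _.
  by rewrite addnC ltnW.
case: (pselect (exists2 a, a \in N i :\: bad & a \notin Qp i)) => [[a]|h]; last first.
  left; apply: (@leq_trans #|N i :\: bad|).
    have := cardsID bad (N i).
    have : (#|N i :&: bad| <= #|bad|)%N by apply: subset_leq_card; exact: finset.subsetIr.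
    by lia.
  apply: subset_leq_card; apply/fintype.subsetP => a aN; rewrite inE.
  apply/andP; split; first by move: aN; rewrite inE => /andP[].
  by apply/negPn/negP => aQ; apply: h; exists a.
rewrite finset.in_setD inE => /andP[nbad aN] aQ; rewrite aN /= -leNgt in nbad.
right.
have {aQ} sub : N a :&: N i \subset Qm i by case: (Nsides _ _ aN) => // /(negP aQ).
(* a is good, so k u_a <= |N a| u_i with u_a >= (1 - 1/t) u_i *)
have card_a : (k * (t - 1) <= t * #|N a|)%N.
  rewrite -(ler_nat R) -(ler_pM2r ui) !natrM natrB //.
  have h1 := le_trans (uk a) (sumle a).
  have tR : 0 < t%:R :> R by rewrite ltr0n.
  have h3 : t%:R * (k%:R * u a) <= t%:R * (#|N a|%:R * u i) by rewrite ler_pM2l.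
  apply: le_trans (_ : t%:R * (k%:R * u a) <= _); last by rewrite -mulrA.
  have h4 : k%:R * (t%:R * (u i - u a)) <= k%:R * u i by rewrite ler_wpM2l ?ler0n.
  lra.
have cardI : (#|N a| + #|N i| <= #|N2 i| + #|N a :&: N i|)%N.
  rewrite -cardsUI leq_add2r; apply: subset_leq_card.
  by rewrite finset.subUset NN2.
apply: leq_trans (_ : #|N a :&: N i| <= _)%N.
  suff : (k * t <= (#|N a| + t * e - e) * t)%N by rewrite leq_pmul2r //; lia.
  have -> : ((#|N a| + t * e - e) * t = t * #|N a| + t * (t - 1) * e)%N by nia.
  have -> : (k * t = k * (t - 1) + k)%N by nia.
  exact: leq_add.
by apply: subset_leq_card; rewrite finset.subsetI finset.subsetIr sub.
Qed.

End Overloaded.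

(** * Complex measurability and the event that the spectral radius is small *)

Section ComplexMeasurable.
Context {R : realType} {disp : measure_display} {T : measurableType disp}.
Implicit Types f g : T -> R[i].

Lemma complex_measurable_cst (z : R[i]) : complex_measurable (fun _ : T => z).
Proof. by split; exact: measurable_cst. Qed.

Lemma complex_measurableD f g : complex_measurable f -> complex_measurable g ->
  complex_measurable (fun x => f x + g x).
Proof.
move=> [f1 f2] [g1 g2]; split.
  rewrite (_ : (fun _ => _) = (fun x => complex.Re (f x) + complex.Re (g x))).
    exact: measurable_funD.
  by apply/funext => x; case: (f x) (g x) => [? ?] [? ?].
rewrite (_ : (fun _ => _) = (fun x => complex.Im (f x) + complex.Im (g x))).
  exact: measurable_funD.
by apply/funext => x; case: (f x) (g x) => [? ?] [? ?].
Qed.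

Lemma complex_measurableM f g : complex_measurable f -> complex_measurable g ->
  complex_measurable (fun x => f x * g x).
Proof.
move=> [f1 f2] [g1 g2]; split.
  rewrite (_ : (fun _ => _) = (fun x => complex.Re (f x) * complex.Re (g x)
    - complex.Im (f x) * complex.Im (g x))).
    by apply: measurable_funB; exact: measurable_funM.
  by apply/funext => x; case: (f x) (g x) => [? ?] [? ?].
rewrite (_ : (fun _ => _) = (fun x => complex.Re (f x) * complex.Im (g x)
    + complex.Im (f x) * complex.Re (g x))).
  by apply: measurable_funD; exact: measurable_funM.
by apply/funext => x; case: (f x) (g x) => [? ?] [? ?].
Qed.

Lemma complex_measurable_sum (I : Type) (s : seq I) (h : I -> T -> R[i]) :
  (forall i, complex_measurable (h i)) ->
  complex_measurable (fun x => \sum_(i <- s) h i x).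
Proof.
move=> mh; elim: s => [|i s IH].
  under eq_fun do rewrite big_nil; exact: complex_measurable_cst.
by under eq_fun do rewrite big_cons; exact: complex_measurableD.
Qed.

Lemma complex_measurable_prod (I : Type) (s : seq I) (h : I -> T -> R[i]) :
  (forall i, complex_measurable (h i)) ->
  complex_measurable (fun x => \prod_(i <- s) h i x).
Proof.
move=> mh; elim: s => [|i s IH].
  under eq_fun do rewrite big_nil; exact: complex_measurable_cst.
by under eq_fun do rewrite big_cons; exact: complex_measurableM.
Qed.

Lemma complex_measurable_det n (A : T -> 'M[R[i]]_n) :
  (forall i j, complex_measurable (fun w => A w i j)) ->
  complex_measurable (fun w => \det (A w)).
Proof.
move=> mA; rewrite /determinant; apply: complex_measurable_sum => s.
apply: complex_measurableM; first exact: complex_measurable_cst.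
by apply: complex_measurable_prod => i; exact: mA.
Qed.

Lemma measurable_normc f : complex_measurable f ->
  measurable_fun setT (fun x => Normc.normc (f x)).
Proof.
move=> [f1 f2].
rewrite (_ : (fun _ => _) = (fun x => Num.sqrt (complex.Re (f x) ^+ 2 +
   complex.Im (f x) ^+ 2))); last first.
  by apply/funext => x; case: (f x) => [? ?].
apply: (@measurableT_comp _ _ _ _ _ _ (@Num.sqrt R)).
  by apply: continuous_measurable_fun; exact: sqrt_continuous.
by apply: measurable_funD; exact: measurable_funX.
Qed.

End ComplexMeasurable.

Section SpectralRadius.
Context {R : realType}.
Local Notation normc := (@Normc.normc R).

Lemma normc_ge0 (z : R[i]) : 0 <= normc z.
Proof. by case: z => a b; exact: sqrtr_ge0. Qed.

Lemma normc_prod (I : Type) (s : seq I) (h : I -> R[i]) :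
  normc (\prod_(i <- s) h i) = \prod_(i <- s) normc (h i).
Proof. by apply: big_morph; [exact: Normc.normcM | exact: Normc.normc1]. Qed.

Lemma normc_sum (I : Type) (s : seq I) (h : I -> R[i]) :
  normc (\sum_(i <- s) h i) <= \sum_(i <- s) normc (h i).
Proof.
elim: s => [|i s IH]; first by rewrite !big_nil Normc.normc0.
by rewrite !big_cons; apply: le_trans (le_normcD _ _) _; rewrite lerD2l.
Qed.

Lemma normc_le_ReIm (z : R[i]) : normc z <= `|complex.Re z| + `|complex.Im z|.
Proof.
case: z => a b /=; rewrite -(ger0_norm (addr_ge0 (normr_ge0 a) (normr_ge0 b))).
rewrite -sqrtr_sqr ler_sqrt ?sqr_ge0 //.
rewrite -(real_normK (num_real a)) -(real_normK (num_real b)).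
have := mulr_ge0 (normr_ge0 a) (normr_ge0 b); nra.
Qed.

Lemma rat_complex_dense (z : R[i]) (e : R) : 0 < e ->
  exists q : rat * rat, normc ((ratr q.1 +i* ratr q.2)%C - z) < e.
Proof.
case: z => a b e0.
have [p] : exists q : rat, ratr q \in `]a - e / 2, a + e / 2[.
  by apply: rat_in_itvoo; lra.
have [q] : exists q : rat, ratr q \in `]b - e / 2, b + e / 2[.
  by apply: rat_in_itvoo; lra.
move=> qb pa; exists (p, q); apply: le_lt_trans (normc_le_ReIm _) _.
move: qb pa; rewrite !in_itv /= => qb pa.
by rewrite (splitr e) ltrD // ltr_norml; lra.
Qed.

(** If all the roots lie in the disc of radius c, each factor is at least
    |z| - c.  Conversely, near a root outside the disc the product is small while
    (|z| - c)^n is not, and points with rational coordinates come arbitrarily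
    close to that root.  Only countably many conditions remain, each of them on
    the polynomial rather than on the enumeration of its roots. *)
Lemma roots_in_disc (n : nat) (lam : 'I_n -> R[i]) (c : R) :
  (forall i, normc (lam i) <= c) <->
  (forall q : rat * rat, let z := (ratr q.1 +i* ratr q.2)%C in c < normc z ->
     (normc z - c) ^+ n <= normc (\prod_(i < n) (z - lam i))).
Proof.
split=> [lamc q z cz | H i].
  rewrite normc_prod -[X in _ ^+ X](card_ord n) -prodr_const; apply: ler_prod => i _.
  rewrite subr_ge0 ltW //= lerBlDr.
  apply: le_trans (lerD (lexx _) (lamc i)).
  by apply: le_trans (le_normcD _ _); rewrite subrK.
rewrite leNgt; apply/negP => ci.
pose M := \sum_(l < n) normc (lam l).
have lamM l : normc (lam l) <= M.
  by rewrite /M (bigD1 l) //= lerDl sumr_ge0 // => ? _; exact: normc_ge0.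
(* for z within e of lam i, each factor of the product is at most D, one of
   them is less than e, and |z| - c stays above g *)
pose g := (normc (lam i) - c) / 2.
have g0 : 0 < g by rewrite /g; lra.
pose D := 2 * M + 1.
have D1 : 1 <= D by have := lamM i; have := normc_ge0 (lam i); rewrite /D; lra.
pose e := Num.min (Num.min g 1) ((g / D) ^+ n).
have gDn : 0 < (g / D) ^+ n by rewrite exprn_gt0 // divr_gt0 //; lra.
have e0 : 0 < e by rewrite !lt_min g0 ltr01 gDn.
have [q hq] := rat_complex_dense (lam i) e e0.
set z := (_ +i* _)%C in hq.
have [eg e1 eD] : [/\ e <= g, e <= 1 & e <= (g / D) ^+ n].
  by split; rewrite !ge_min lexx ?orbT.
have zg : g < normc z - c.
  have nB : normc (lam i - z) = normc (z - lam i) by rewrite -normcN opprB.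
  have := le_normcD (lam i - z) z; rewrite subrK nB.
  rewrite /g in eg *; lra.
have := H q; rewrite -/z => /(_ _)/wrap[]; first by lra.
apply/negP; rewrite -ltNge normc_prod.
apply: lt_le_trans (_ : g ^+ n <= _); last first.
  by apply: lerXn2r; rewrite ?nnegrE; lra.
rewrite (bigD1 i) //=.
apply: le_lt_trans (_ : normc (z - lam i) * D ^+ n < _).
  apply: ler_wpM2l; first exact: normc_ge0.
  apply: le_trans (_ : \prod_(l < n | l != i) D <= _).
    apply: ler_prod => l _; rewrite normc_ge0 /=.
    apply: le_trans (le_normcD _ _) _; rewrite normcN.
    have := le_normcD (z - lam i) (lam i); rewrite subrK.
    have := lamM i; have := lamM l; rewrite /D; lra.
  rewrite prodr_const; apply: ler_weXn2l => //.
  by rewrite -[leqRHS]card_ord; exact: max_card.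
apply: lt_le_trans (_ : (g / D) ^+ n * D ^+ n <= _).
  by rewrite ltr_pM2r ?exprn_gt0 ?(lt_le_trans hq) //; lra.
by rewrite -exprMn divfK //; lra.
Qed.

Context {disp : measure_display} {T : measurableType disp}.

(** The event depends on lam only through the characteristic polynomial of A,
    whose value at each point is a measurable function of w. *)
Lemma measurable_spectral_radius_le (n : nat) (A : T -> 'M[R[i]]_n)
    (lam : T -> 'I_n -> R[i]) (c : R) :
  (forall i j, complex_measurable (fun w => A w i j)) ->
  (forall w, eigenvalues_of (A w) (lam w)) ->
  measurable [set w | forall i, normc (lam w i) <= c].
Proof.
move=> mA Alam.
have charE w z : \prod_(i < n) (z - lam w i) = \det (z%:M - A w).
  have -> : \det (z%:M - A w) = (char_poly (A w)).[z].
    rewrite /char_poly -horner_evalE -det_map_mx; congr (\det _).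
    apply/matrixP => i j; rewrite !mxE /= /horner_eval !hornerE.
    by case: (i == j); rewrite ?mulr1n ?mulr0n !hornerE.
  rewrite (Alam w) horner_prod; apply: eq_bigr => i _.
  by rewrite !hornerE.
pose zq (q : rat * rat) : R[i] := (ratr q.1 +i* ratr q.2)%C.
have -> : [set w | forall i, normc (lam w i) <= c] =
    ~` (\bigcup_(q : rat * rat) [set w | c < normc (zq q) /\
      normc (\det ((zq q)%:M - A w)) < (normc (zq q) - c) ^+ n]).
  apply/seteqP; split => w /=.
    move=> /roots_in_disc H [q _ /= [cq]].
    by apply/negP; rewrite -leNgt -charE; exact: H.
  move=> H; apply/roots_in_disc => q z cz; rewrite leNgt; apply/negP => h.
  by apply: H; exists q => //; split; rewrite // -charE.
apply: measurableC; apply: countable_bigcupT_measurable; first exact: countableP.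
move=> q; case: (ltP c (normc (zq q))) => cz; last first.
  by rewrite (_ : [set w | _] = set0) //; apply/seteqP; split => // w [].
rewrite (_ : [set w | _] = (fun w => normc (\det ((zq q)%:M - A w))) @^-1`
   `]-oo, (normc (zq q) - c) ^+ n[%classic); last first.
  by apply/seteqP; split => w /=; rewrite in_itv /= => //; case.
rewrite -[X in measurable X]setTI.
suff : measurable_fun setT (fun w => normc (\det ((zq q)%:M - A w))) by apply.
apply: measurable_normc; apply: complex_measurable_det => i j.
rewrite (_ : (fun _ => _) = fun w => (zq q) *+ (i == j) + -1 * A w i j); last first.
  by apply/funext => w; rewrite !mxE mulN1r.
apply: complex_measurableD; first exact: complex_measurable_cst.
by apply: complex_measurableM => //; exact: complex_measurable_cst.
Qed.

End SpectralRadius.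

(** * From eigenvectors to nonnegative vectors *)

Section Eigenvalues.
Context {R : realType}.
Local Notation normc := (@Normc.normc R).

(** The hypothesis on u is used for the moduli of an eigenvector: at the vertex p
    that it provides, the eigenvalue equation gives |lam i| u_p <= s k u_p. *)
Lemma eigenvalue_le_rows (n : nat) (A : 'M[R[i]]_n) (lam : 'I_n -> R[i])
    (adj : rel 'I_n) (s : R) (k : nat) : eigenvalues_of A lam -> 0 <= s ->
  (forall q p, normc (A q p) <= s) -> (forall q p, ~~ adj p q -> A q p = 0) ->
  (forall u : 'I_n -> R, (forall i, 0 <= u i) -> (exists i, 0 < u i) ->
    exists p, \sum_(q < n | adj p q) u q < k%:R * u p) ->
  forall i, normc (lam i) <= k%:R * s.
Proof.
move=> Alam s0 As Afar small i.
have : eigenvalue A (lam i).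
  rewrite eigenvalue_root_char Alam /root horner_prod (bigD1 i) //=.
  by rewrite hornerXsubC subrr mul0r.
move=> /eigenvalueP[v vA /rV0Pn[i0 vi0]].
pose u q := normc (v ord0 q).
have u0 q : 0 <= u q by exact: normc_ge0.
have [|p up] := small u u0.
  exists i0; rewrite lt0r u0 andbT; apply: contra vi0 => /eqP.
  by move=> /Normc.eq0_normc ->.
have upos : 0 < u p.
  rewrite lt0r u0 andbT; apply/eqP => up0; move: up; rewrite up0 mulr0 ltNge.
  by rewrite sumr_ge0.
have : normc (lam i) * u p <= s * \sum_(q < n | adj p q) u q.
  rewrite -Normc.normcM; have -> : lam i * v ord0 p = \sum_q v ord0 q * A q p.
    by have /matrixP/(_ ord0 p) := vA; rewrite !mxE => ->.
  apply: le_trans (normc_sum _ _ _) _.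
  rewrite mulr_sumr [leRHS]big_mkcond; apply: ler_sum => q _.
  case: ifPn => pq; first by rewrite Normc.normcM mulrC; apply: ler_wpM2r; [exact: u0 | exact: As].
  by rewrite Afar // mulr0 Normc.normc0.
move=> /le_trans/(_ (ler_wpM2l s0 (ltW up))).
by rewrite mulrA ler_pM2r // mulrC.
Qed.

End Eigenvalues.

(** * First moment bound for clusters of independent points *)

Section FirstMoment.
Context {R : realType} {disp : measure_display} {T : measurableType disp}.
Variable P : probability T R.

Lemma measurable_forall_fin {J : finType} (F : J -> set T) :
  (forall i, measurable (F i)) -> measurable [set w | forall i, F i w].
Proof.
move=> mF.
have -> : [set w | forall i, F i w] = \big[setI/setT]_(i <- enum J) F i.
  rewrite -bigcap_seq /=; apply/seteqP; split=> w /= h i //.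
  by apply: h; rewrite /= mem_enum.
by apply: bigsetI_measurable.
Qed.

Lemma subset_of_card {J : finType} (A : {set J}) m :
  (m <= #|A|)%N -> exists2 B : {set J}, B \subset A & #|B| = m.
Proof.
move=> /card_geqP[s [us <- sA]]; exists [set:: s]%SET.
  by apply/fintype.subsetP => x; rewrite inE => /sA.
by rewrite cardsE; apply/card_uniqP.
Qed.

Lemma finite_union_bound {J : finType} (D : {set J}) (F : J -> set T) (c : R) :
  (forall i, i \in D -> measurable (F i)) ->
  (forall i, i \in D -> (P (F i) <= c%:E)%E) ->
  measurable (\big[setU/set0]_(i in D) F i) /\
  (P (\big[setU/set0]_(i in D) F i) <= (#|D|%:R * c)%:E)%E.
Proof.
move=> mF Fc.
have mU : measurable (\big[setU/set0]_(i in D) F i) by exact: bigsetU_measurable.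
split => //.
apply: (@le_trans _ _ (\sum_(i in D) P (F i))%E).
  have : (forall i, i \in enum D -> measurable (F i)).
    by move=> i; rewrite mem_enum; exact: mF.
  rewrite -big_enum -[X in (_ <= X)%E]big_enum /=.
  elim: (enum D) => [|i s IH] ms; first by rewrite !big_nil measure0.
  have ms' : forall j, j \in s -> measurable (F j).
    by move=> j js; apply: ms; rewrite in_cons js orbT.
  rewrite !big_cons; apply: le_trans (measureU2 _ _ _) _.
  - by apply: ms; rewrite mem_head.
  - by rewrite big_seq; exact: bigsetU_measurable.
  - by rewrite leeD2l // IH.
apply: le_trans (lee_sum _ Fc) _.
by rewrite sumEFin sumr_const mulr_natl.
Qed.

Context {disp' : measure_display} {T' : measurableType disp'}.

(** Union bound over the sets S of k points in A and the subsets S' of S of s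
    points in B; for fixed S and S' the event is a product over the points, which
    is all that the definition of independence speaks of. *)
Lemma first_moment_clusters (n : nat) (X : 'I_n -> {RV P >-> T'}) (A B : set T')
  (a b : R) (k s : nat) :
  independent_RVs X -> measurable A -> measurable B -> B `<=` A ->
  (forall i, (P (X i @^-1` A) <= a%:E)%E) ->
  (forall i, (P (X i @^-1` B) <= b%:E)%E) ->
  (s <= k)%N ->
  exists F : set T, [/\ measurable F,
    (P F <= ('C(n, k)%:R * ('C(k, s)%:R * (b ^+ s * a ^+ (k - s))))%:E)%E &
    forall w, (k <= #|[set i | `[< A (X i w) >]]%SET|)%N ->
      (s <= #|[set i | `[< B (X i w) >]]%SET|)%N -> F w].
Proof.
move=> indep mA mB BA Pa Pb sk.
have mpre i (C : set T') : measurable C -> measurable (X i @^-1` C).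
  by move=> mC; rewrite -[X in measurable X]setTI; exact: measurable_funP.
(* the points outside S are unconstrained, hence the value setT *)
pose hit (S S' : {set 'I_n}) (i : 'I_n) : set T' :=
  if i \in S' then B else if i \in S then A else setT.
have mhit S S' i : measurable (hit S S' i) by rewrite /hit; do 2?case: ifP => //.
pose G (S S' : {set 'I_n}) : set T := [set w | forall i, hit S S' i (X i w)].
have mG S S' : measurable (G S S').
  by apply: measurable_forall_fin => i; apply: (mpre i).
pose subs (S : {set 'I_n}) := [set S' : {set 'I_n} | S' \subset S & #|S'| == s]%SET.
pose sets := [set S : {set 'I_n} | #|S| == k]%SET.
have PG S S' : S \in sets -> S' \in subs S ->
    (P (G S S') <= (b ^+ s * a ^+ (k - s))%:E)%E.
  rewrite !inE => /eqP cS /andP[S'S /eqP cS'].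
  rewrite indep //.
  have -> : b ^+ s * a ^+ (k - s) =
      \prod_(i < n) (if i \in S' then b else if i \in S then a else 1).
    rewrite (bigID (mem S')) /=; congr (_ * _).
      by rewrite (eq_bigr (fun _ => b)) ?prodr_const ?cS' // => i ->.
    rewrite (bigID (mem S)) /= [X in _ * X]big1 ?mulr1; last first.
      by move=> i /andP[/negbTE -> /negbTE ->].
    rewrite (eq_bigr (fun _ => a)); last by move=> i /andP[/negbTE -> ->].
    rewrite prodr_const; congr (_ ^+ _).
    rewrite -cS -cS' -cardsDS //; apply: eq_card => i.
    by rewrite inE.
  rewrite -prodEFin.
  suff /andP[] : (0 <= \prod_(i < n) P (X i @^-1` hit S S' i) <=
    \prod_(i < n) (if i \in S' then b else if i \in S then a else 1)%:E)%E by [].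
  elim/big_ind2 : _ => [|x1 y1 x2 y2 /andP[? ?] /andP[? ?]|i _].
  - by rewrite lee01 lexx.
  - by rewrite mule_ge0 //= lee_pmul.
  - rewrite measure_ge0 /= /hit; case: ifP => // _; case: ifP => // _.
    by rewrite preimage_setT probability_setT.
have boundS S : S \in sets -> 
  measurable (\big[setU/set0]_(S' in subs S) G S S') /\
  (P (\big[setU/set0]_(S' in subs S) G S S') <=
   ('C(k, s)%:R * (b ^+ s * a ^+ (k - s)))%:E)%E.
  move=> Ss; have := @finite_union_bound _ (subs S) (G S) (b ^+ s * a ^+ (k - s)).
  rewrite /subs cards_draws; move: (Ss); rewrite inE => /eqP -> h.
  by apply: h => // S' ?; exact: PG.
have [mF PF] := @finite_union_bound _ sets _ _ (fun S h => (boundS S h).1)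
  (fun S h => (boundS S h).2).
exists (\big[setU/set0]_(S in sets) \big[setU/set0]_(S' in subs S) G S S').
split => //.
  by move: PF; rewrite /sets card_draws card_ord.
move=> w kA sB.
have [S' S'B cS'] := subset_of_card _ _ sB.
pose HA := [set i | `[< A (X i w) >]]%SET.
have S'A : S' \subset HA.
  apply: fintype.subset_trans S'B _; apply/fintype.subsetP => i.
  by rewrite !inE; exact: BA.
have [|T0 T0A cT0] := @subset_of_card _ (HA :\: S')%SET (k - s).
  by rewrite cardsDS // cS' leq_sub2r.
have disj : S' :&: T0 = finset.set0.
  apply/finset.setP => i; rewrite finset.in_setI finset.in_set0.
  by apply/negP => /andP[iS' /(fintype.subsetP T0A)]; rewrite finset.in_setD iS'.
rewrite -bigcup_pred; exists (S' :|: T0)%SET => /=.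
  by rewrite inE cardsU disj cards0 subn0 cS' cT0 subnKC.
rewrite -bigcup_pred; exists S' => /=.
  by rewrite !inE finset.subsetUl cS' eqxx.
move=> i; rewrite /hit; case: ifP => [iS'|_].
  by have := fintype.subsetP S'B _ iS'; rewrite !inE.
case: ifP => //; rewrite finset.in_setU.
move=> /orP[/(fintype.subsetP S'A)|/(fintype.subsetP T0A)].
  by rewrite !inE.
by rewrite finset.in_setD => /andP[_]; rewrite !inE.
Qed.

End FirstMoment.

(** * The measure of boxes and the uniform law on the cube *)

Section Lebesgue.
Context {R : realType}.

Lemma lebesgue_rV0 d : @lebesgue_rV R d set0 = 0%E.
Proof.
elim: d => [|d IH] /=; first by rewrite diracE in_set0.
by rewrite (eq_integral (fun _ => 0%E)) ?integral0 // => x _; exact: IH.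
Qed.

(** By induction on d: the sections of a product set are either empty or equal to
    the product of the remaining factors, so the iterated integral factorises. *)
Lemma lebesgue_rV_prod d (A : 'I_d -> set R) : (forall l, measurable (A l)) ->
  lebesgue_rV [set x : 'rV[R]_d | forall l, A l (x ord0 l)] =
  (\prod_(l < d) lebesgue_measure (A l))%E.
Proof.
elim: d A => [|d IH] A mA.
  rewrite big_ord0 /= diracE mem_set // => -[].
  by [].
rewrite big_ord_recl /= -IH; last by move=> l; exact: mA.
set c := lebesgue_rV _.
have c0 : (0 <= c)%E by rewrite /c (IH (fun l => A (lift ord0 l))) //; exact: prode_ge0.
rewrite muleC -(setTI (A ord0)) -integral_cst //=; last by rewrite setTI; exact: mA.

rewrite [RHS]integral_mkcond /=.
apply: eq_integral => x _; rewrite patchE setTI.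
have row0 (y : 'rV[R]_d) : row_mx (x%:M : 'rV[R]_1) y ord0 ord0 = x.
  by rewrite (_ : ord0 = lshift d (ord0 : 'I_1)) ?row_mxEl ?mxE //; apply/val_inj.
have rowS (y : 'rV[R]_d) l :
    row_mx (x%:M : 'rV[R]_1) y ord0 (lift ord0 l) = y ord0 l.
  by rewrite (_ : lift ord0 l = rshift 1 l) ?row_mxEr //; apply/val_inj.
case: ifPn => xA.
  congr lebesgue_rV; apply/seteqP; split => y /=.
    by move=> h l; have := h (lift ord0 l); rewrite rowS.
  move=> h l; case: (unliftP ord0 l) => [k|] ->; first by rewrite rowS.
  by rewrite row0; apply/set_mem.
transitivity (lebesgue_rV (set0 : set 'rV[R]_d)); last exact: lebesgue_rV0.
congr lebesgue_rV; apply/seteqP; split => // y /=.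
by move=> /(_ ord0); rewrite row0 => /mem_set; rewrite (negbTE xA).
Qed.

End Lebesgue.

Section RowVectors.
Context {R : realType}.

Lemma measurable_coord d (l : 'I_d) :
  measurable_fun setT (fun x : 'rV[R]_d => x ord0 l).
Proof.
move=> _ Y mY; rewrite setTI; apply: sub_sigma_algebra => /=.
rewrite -bigcup_seq /=; exists l => /=; first by rewrite mem_index_enum.
by exists Y => //; rewrite setTI.
Qed.

Lemma measurable_rV_prod d (A : 'I_d -> set R) : (forall l, measurable (A l)) ->
  measurable [set x : 'rV[R]_d | forall l, A l (x ord0 l)].
Proof.
move=> mA.
apply: (@measurable_forall_fin _ _ _ (fun l => (fun x : 'rV[R]_d => x ord0 l) @^-1` A l)).
by move=> l; rewrite -[X in measurable X]setTI; exact: measurable_coord.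
Qed.

Lemma measurable_fun_rV {disp : measure_display} {T : measurableType disp} d
    (g : T -> 'rV[R]_d) :
  (forall l, measurable_fun setT (fun w => g w ord0 l)) -> measurable_fun setT g.
Proof.
move=> mg.
apply: (measurability (\big[setU/set0]_(l < d)
  preimage_set_system setT (fun x : 'rV[R]_d => x ord0 l) measurable)) => //.
rewrite -bigcup_seq => _ [_ [l _ [B mB <-]] <-].
by rewrite !setTI; have := mg l measurableT _ mB; rewrite setTI.
Qed.

Lemma OmegaE d : @Omega R d =
  [set x | forall l, `[- 2^-1, 2^-1]%classic (x ord0 l)].
Proof. by apply/seteqP; split => x /= Ox l; have := Ox l; rewrite in_itv. Qed.

Lemma measurable_Omega d : measurable (@Omega R d).
Proof.
rewrite OmegaE; apply: (measurable_rV_prod d (fun=> `[- 2^-1, 2^-1]%classic)) => l.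
exact: measurable_itv.
Qed.

Lemma lebesgue_Omega d : lebesgue_rV (@Omega R d) = 1%E.
Proof.
rewrite OmegaE (lebesgue_rV_prod d (fun=> `[- 2^-1, 2^-1]%classic)) //.
rewrite big1 // => l _; rewrite lebesgue_measure_itv /= lte_fin ifT; last lra.
by rewrite -EFinB; congr (_%:E); lra.
Qed.

Context {disp : measure_display} {T : measurableType disp} (P : probability T R).

(** The cube has measure 1, so the uniform law is Lebesgue measure on it. *)
Lemma uniform_box_le d (X : {RV P >-> 'rV[R]_d}) (A : 'I_d -> set R) :
  uniformly_distributed X (@Omega R d) -> (forall l, measurable (A l)) ->
  (P (X @^-1` [set x : 'rV[R]_d | forall l, A l (x ord0 l)]) <=
   \prod_(l < d) lebesgue_measure (A l))%E.
Proof.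
move=> unif mA; have := unif _ (measurable_rV_prod d A mA).
rewrite /distribution /pushforward => ->.
rewrite lebesgue_Omega /= invr1 mul1e.
pose B l := A l `&` `[- 2^-1, 2^-1]%classic.
have mB l : measurable (B l) by apply: measurableI => //; exact: measurable_itv.
rewrite OmegaE (_ : _ `&` _ = [set x : 'rV[R]_d | forall l, B l (x ord0 l)]); last first.
  apply/seteqP; split => x /=; first by move=> [Ax Ox] l; split; [exact: Ax|exact: Ox].
  by move=> Bx; split => l; have [] := Bx l.
rewrite lebesgue_rV_prod //.
suff /andP[] : (0 <= \prod_(l < d) lebesgue_measure (B l) <=
  \prod_(l < d) lebesgue_measure (A l))%E by [].
elim/big_ind2 : _ => [|x1 y1 x2 y2 /andP[? ?] /andP[? ?]|l _].
- by rewrite lee01 lexx.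
- by rewrite mule_ge0 //= lee_pmul.
- rewrite measure_ge0 /=; apply: le_measure; [exact: (mem_set (mB l))|exact: (mem_set (mA l))|].
  by move=> x [].
Qed.

Lemma uniform_Omega d (X : {RV P >-> 'rV[R]_d}) :
  uniformly_distributed X (@Omega R d) -> P (X @^-1` @Omega R d) = 1%E.
Proof.
move=> /(_ _ (measurable_Omega d)); rewrite /distribution /pushforward => ->.
by rewrite setIid lebesgue_Omega /= invr1 mule1.
Qed.

Lemma all_in_Omega n d (X : 'I_n -> {RV P >-> 'rV[R]_d}) :
  (forall i, uniformly_distributed (X i) (@Omega R d)) -> independent_RVs X ->
  P [set w | forall i, Omega (X i w)] = 1%E.
Proof.
move=> unif /(_ (fun _ => @Omega R d)) ->; last by move=> _; exact: measurable_Omega.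
by rewrite big1 // => i _; exact: uniform_Omega.
Qed.

End RowVectors.

Section Cells.
Context {R : realType} {d : nat}.
Variable h : R.
Hypothesis h_gt0 : 0 < h.

(** The index of the grid cell of mesh h containing x along the coordinate l,
    counted from the face -1/2 of the cube so that it is a natural number. *)
Definition cell (x : 'rV[R]_d) (l : 'I_d) : nat :=
  Num.truncn ((x ord0 l + 2^-1) / h).

(** The union of the grid cells whose index in each coordinate l is between
    y l - lo l and y l + hi l. *)
Definition window (y lo hi : 'I_d -> nat) : set 'rV[R]_d :=
  [set x | forall l, `[((y l)%:R - (lo l)%:R) * h - 2^-1,
     ((y l)%:R + (hi l)%:R + 1) * h - 2^-1[%classic (x ord0 l)].

Lemma cellP (x : 'rV[R]_d) l : Omega x ->
  (cell x l)%:R * h <= x ord0 l + 2^-1 < ((cell x l)%:R + 1) * h.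
Proof.
move=> /(_ l) /andP[x1 x2]; rewrite -ler_pdivlMr // -ltr_pdivrMr //.
rewrite natr1; apply: Num.Theory.truncn_itv.
apply: divr_ge0; [lra | exact: ltW].
Qed.

Lemma cell_le (x : 'rV[R]_d) l : Omega x -> (cell x l <= Num.truncn h^-1)%N.
Proof.
move=> Ox; have /andP[x1 x2] := Ox l; apply: le_truncn.
rewrite -[leRHS]mul1r ler_pM2r ?invr_gt0 //; lra.
Qed.

Lemma cell_close (x y : 'rV[R]_d) l (m : nat) : Omega x -> Omega y ->
  x ord0 l - y ord0 l <= m%:R * h -> (cell x l <= cell y l + m)%N.
Proof.
move=> Ox Oy xy; have /andP[x1 _] := cellP x l Ox; have /andP[_ y2] := cellP y l Oy.
rewrite -ltnS -(ltr_nat R) -natr1 natrD -(ltr_pM2r h_gt0).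
rewrite mulrDl mulrDl mul1r; move: y2; rewrite mulrDl mul1r; lra.
Qed.

Lemma cell_window (x : 'rV[R]_d) (y lo hi : 'I_d -> nat) : Omega x ->
  (forall l, (y l <= cell x l + lo l)%N && (cell x l <= y l + hi l)%N) ->
  window y lo hi x.
Proof.
move=> Ox H l; have /andP[lol hil] := H l; rewrite /= in_itv /=.
have /andP[x1 x2] := cellP x l Ox.
rewrite lerBlDr ltrBrDr; apply/andP; split.
  apply: le_trans x1; rewrite ler_pM2r //.
  by rewrite lerBlDr -natrD ler_nat.
apply: lt_le_trans x2 _; rewrite ler_pM2r //.
by rewrite lerD2r -natrD ler_nat.
Qed.

Lemma measurable_window (y lo hi : 'I_d -> nat) : measurable (window y lo hi).
Proof.
exact: (measurable_rV_prod d (fun l => `[((y l)%:R - (lo l)%:R) * h - 2^-1,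
  ((y l)%:R + (hi l)%:R + 1) * h - 2^-1[%classic) (fun l => measurable_itv _)).
Qed.

Lemma window_subset (y lo hi lo' hi' : 'I_d -> nat) :
  (forall l, (lo l <= lo' l)%N) -> (forall l, (hi l <= hi' l)%N) ->
  window y lo hi `<=` window y lo' hi'.
Proof.
move=> lolo hihi x W l; have := W l; rewrite /= !in_itv /= => /andP[w1 w2].
have := lolo l; have := hihi l; rewrite -!(ler_nat R) => h2 h1.
apply/andP; split.
  by apply: le_trans w1; rewrite lerD2r ler_pM2r // lerD2l lerN2.
by apply: lt_le_trans w2 _; rewrite lerD2r ler_pM2r // lerD2r lerD2l.
Qed.

Context {disp : measure_display} {T : measurableType disp} (P : probability T R).

Lemma window_prob_le (X : {RV P >-> 'rV[R]_d}) (y lo hi : 'I_d -> nat) :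
  uniformly_distributed X (@Omega R d) ->
  (P (X @^-1` window y lo hi) <=
   (\prod_(l < d) (((lo l)%:R + (hi l)%:R + 1) * h))%:E)%E.
Proof.
move=> unif; have := (uniform_box_le P d X
  (fun l => `[((y l)%:R - (lo l)%:R) * h - 2^-1,
     ((y l)%:R + (hi l)%:R + 1) * h - 2^-1[%classic) unif
  (fun l => measurable_itv _)).
move=> /le_trans; apply.
rewrite -prodEFin le_eqVlt; apply/orP; left; apply/eqP; apply: eq_bigr => l _.
rewrite lebesgue_measure_itv /= lte_fin ifT.
  by rewrite -EFinB; congr (_%:E); ring.
rewrite ltrD2r ltr_pM2r // -addrA ltrD2l.
by apply: lt_le_trans (_ : 0 + 1 <= _); rewrite ?add0r ?lerD2r; 
  have := ler0n R (hi l); have := ler0n R (lo l); lra.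
Qed.

End Cells.

(** * The exceptional event *)

Section Clusters.
Context {R : realType} {d : nat} (l0 : 'I_d).
Context {disp : measure_display} {T : measurableType disp} (P : probability T R).
Variables (h : R) (L : nat).
Hypothesis h_gt0 : 0 < h.

Definition far_reach : 'I_d -> nat := fun=> (4 * L)%N.
Definition near_reach : 'I_d -> nat := fun=> (2 * L)%N.
(** A reach shortened in the coordinate l0 only: used on one side of a window
    that extends by near_reach otherwise, it leaves 3L + 1 of the 4L + 1 layers
    of cells. *)
Definition half_reach : 'I_d -> nat := fun l => if l == l0 then L else (2 * L)%N.

Lemma prod_cst (c : R) (F : 'I_d -> R) : (forall l, F l = c) ->
  \prod_(l < d) F l = c ^+ d.
Proof. by move=> Fc; rewrite (eq_bigr (fun=> c)) // prodr_const card_ord. Qed.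

Definition prob_far : R := ((8 * L + 1)%:R * h) ^+ d.
Definition prob_near : R := ((4 * L + 1)%:R * h) ^+ d.
Definition prob_half : R := (3 * L + 1)%:R / (4 * L + 1)%:R * prob_near.

Lemma half_prodE (F : 'I_d -> R) :
  (forall l, F l = (if l == l0 then (3 * L + 1)%:R else (4 * L + 1)%:R) * h) ->
  \prod_(l < d) F l = prob_half.
Proof.
move=> FE; rewrite /prob_half /prob_near.
have -> : ((4 * L + 1)%:R * h) ^+ d = \prod_(l < d) ((4 * L + 1)%:R * h) :> R.
  by rewrite prodr_const card_ord.
rewrite (bigD1 l0) //= [in RHS](bigD1 l0) //= FE eqxx !mulrA; congr (_ * _).
  have : (4 * L + 1)%:R != 0 :> R by rewrite pnatr_eq0 addn1.
  by move=> ?; field.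
by apply: eq_bigr => l /negbTE ll0; rewrite FE ll0.
Qed.

Variables (n : nat) (X : 'I_n -> {RV P >-> 'rV[R]_d}).
Hypothesis X_unif : forall i, uniformly_distributed (X i) (@Omega R d).
Hypothesis X_indep : independent_RVs X.
Variables (k e t : nat).
Hypothesis t_gt0 : (0 < t)%N.
Hypothesis k_le : (k <= t * (t - 1) * e)%N.
Let s := (k - t * e)%N.

(** The first moment bound for one window: the first term is for k + e points in
    the doubled cube, the second one for the two ways of confining s of k points
    to three quarters of the cube. *)
Definition cluster_bound : R :=
  'C(n, k + e)%:R * prob_far ^+ (k + e) +
  2 * ('C(n, k)%:R * ('C(k, s)%:R * (prob_half ^+ s * prob_near ^+ (k - s)))).

Lemma cluster_event_at (y : 'I_d -> nat) : exists F : set T,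
  [/\ measurable F, (P F <= cluster_bound%:E)%E &
   forall w,
    (k + e <= #|[set i | `[< window h y far_reach far_reach (X i w) >]]%SET|)%N \/
    ((k <= #|[set i | `[< window h y near_reach near_reach (X i w) >]]%SET|)%N /\
     ((s <= #|[set i | `[< window h y half_reach near_reach (X i w) >]]%SET|)%N \/
      (s <= #|[set i | `[< window h y near_reach half_reach (X i w) >]]%SET|)%N)) -> F w].
Proof.
have half_near l : (half_reach l <= near_reach l)%N.
  by rewrite /half_reach /near_reach; case: ifP => // _; rewrite mul2n -addnn leq_addr.
have Pfar i : (P (X i @^-1` window h y far_reach far_reach) <= prob_far%:E)%E.
  have := window_prob_le h h_gt0 P (X i) y far_reach far_reach (X_unif i).
  rewrite (prod_cst ((8 * L + 1)%:R * h)) // => l.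
  by congr (_ * _); rewrite /far_reach /= !(natrD, natrM); ring.
have Pnear i : (P (X i @^-1` window h y near_reach near_reach) <= prob_near%:E)%E.
  have := window_prob_le h h_gt0 P (X i) y near_reach near_reach (X_unif i).
  rewrite (prod_cst ((4 * L + 1)%:R * h)) // => l.
  by congr (_ * _); rewrite /near_reach /= !(natrD, natrM); ring.
have Phalf1 i : (P (X i @^-1` window h y half_reach near_reach) <= prob_half%:E)%E.
  have := window_prob_le h h_gt0 P (X i) y half_reach near_reach (X_unif i).
  rewrite half_prodE // => l.
  by congr (_ * _); rewrite /near_reach /half_reach; case: ifP => _; rewrite !(natrD, natrM); ring.
have Phalf2 i : (P (X i @^-1` window h y near_reach half_reach) <= prob_half%:E)%E.
  have := window_prob_le h h_gt0 P (X i) y near_reach half_reach (X_unif i).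
  rewrite half_prodE // => l.
  by congr (_ * _); rewrite /near_reach /half_reach; case: ifP => _; rewrite !(natrD, natrM); ring.
have mW lo hi := measurable_window h y lo hi.
have [F0 [mF0 PF0 F0P]] := @first_moment_clusters _ _ _ _ _ _ n X _ _ _ _ (k + e) (k + e) 
  X_indep (mW far_reach far_reach) (mW far_reach far_reach) (@subset_refl _ _) Pfar Pfar (leqnn _).
have [F1 [mF1 PF1 F1P]] := @first_moment_clusters _ _ _ _ _ _ n X _ _ _ _ k s
  X_indep (mW near_reach near_reach) (mW half_reach near_reach)
  (window_subset h h_gt0 _ _ _ _ _ half_near (fun=> leqnn _)) Pnear Phalf1 (leq_subr _ _).
have [F2 [mF2 PF2 F2P]] := @first_moment_clusters _ _ _ _ _ _ n X _ _ _ _ k s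
  X_indep (mW near_reach near_reach) (mW near_reach half_reach)
  (window_subset h h_gt0 _ _ _ _ _ (fun=> leqnn _) half_near) Pnear Phalf2 (leq_subr _ _).
exists (F0 `|` (F1 `|` F2)); split.
- by apply: measurableU => //; exact: measurableU.
- apply: le_trans (measureU2 _ mF0 (measurableU _ _ mF1 mF2)) _.
  rewrite /cluster_bound EFinD leeD //.
    by move: PF0; rewrite binn mul1r subnn expr0 mulr1.
  apply: le_trans (measureU2 _ mF1 mF2) _.
  by rewrite [2 * _]mulr_natl mulr2n EFinD; apply: leeD.
- move=> w [H|[kn [h1|h2]]]; first by left; exact: F0P.
    by right; left; exact: F1P.
  by right; right; exact: F2P.
Qed.

(** F is the union over all the cells of the events of cluster_event_at,
    together with the null event that some point is outside the cube.  Points at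
    distance at most 2 L h have cell indices differing by at most 2 L, so the
    clustering dichotomy applies to the cell indices and the windows around the
    cell of X_i. *)
Lemma cluster_event : exists F : set T,
  [/\ measurable F,
   (P F <= ((Num.truncn h^-1).+1%:R ^+ d * cluster_bound)%:E)%E &
   forall w, ~ F w -> forall u : 'I_n -> R, (forall i, 0 <= u i) ->
     (exists i, 0 < u i) ->
     exists p, \sum_(q < n | [forall l, `|X q w ord0 l - X p w ord0 l| <= (2 * L)%:R * h]) u q
        < k%:R * u p].
Proof.
pose J := {ffun 'I_d -> 'I_(Num.truncn h^-1).+1}.
have [F FP] := choice (fun y : J => cluster_event_at (fun l => y l)).
have mF y : measurable (F y) by have [] := FP y.
have PF y : (P (F y) <= cluster_bound%:E)%E by have [] := FP y.
pose out := ~` [set w | forall i, Omega (X i w)].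
have m_in : measurable [set w | forall i, Omega (X i w)].
  apply: (@measurable_forall_fin _ _ _ (fun i => X i @^-1` @Omega R d)) => i.
  by rewrite -[X in measurable X]setTI; apply: measurable_funP => //; exact: measurable_Omega.
have mout : measurable out by exact: measurableC.
have Pout : P out = 0%E.
  by rewrite /out probability_setC // all_in_Omega // subee.
have [mU PU] := @finite_union_bound _ _ _ P _ [set: J]%SET F _ (fun y _ => mF y) (fun y _ => PF y).
exists ((\big[setU/set0]_(y in [set: J]%SET) F y) `|` out); split.
- exact: measurableU.
- apply: le_trans (measureU2 _ mU mout) _; rewrite [X in (_ + X)%E](_ : _ = 0%E) ?adde0;
    last exact: Pout.
  apply: le_trans PU _; rewrite cardsT card_ffun !card_ord natrX.
  exact: lexx.
move=> w /not_orP[nF nout] u u0 uex.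
have inO i : Omega (X i w) by move: nout; rewrite /out /= => /contrapT; apply.
apply: contrapT => /forallNP nsum.
pose c i l := cell h (X i w) l.
pose N i := [set q | [forall l, (c i l <= c q l + 2 * L)%N && (c q l <= c i l + 2 * L)%N]]%SET.
pose N2 i := [set q | [forall l, (c i l <= c q l + 4 * L)%N && (c q l <= c i l + 4 * L)%N]]%SET.
pose Qp i := [set q | c i l0 <= c q l0 + L]%N%SET.
pose Qm i := [set q | c q l0 <= c i l0 + L]%N%SET.
have [] := @overloaded_neighbourhood R 'I_n N N2 Qp Qm u k e t _ _ _ t_gt0 k_le u0 uex.
- by move=> i; rewrite inE; apply/forallP => l; rewrite leq_addr.
- move=> i p; rewrite inE => /forallP Nip; apply/fintype.subsetP => q.
  rewrite !inE => /forallP Npq; apply/forallP => l.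
  by have := Nip l; have := Npq l; lia.
- move=> i a; rewrite inE => /forallP Nia.
  case: (leqP (c i l0) (c a l0 + L)) => H; [by left; rewrite inE|right].
  apply/fintype.subsetP => q; rewrite !inE => /andP[/forallP Naq _].
  by have := Naq l0; lia.
- move=> p; have /negP := nsum p; rewrite -leNgt => /le_trans; apply.
  rewrite [leRHS]big_mkcond [leLHS]big_mkcond; apply: ler_sum => q _.
  case: ifP => [/forallP pq|_]; last by case: ifP.
  rewrite ifT // inE; apply/forallP => l; have := pq l; rewrite ler_norml => /andP[h1 h2].
  apply/andP; split; apply: cell_close => //; lra.
move=> i H.
have yP l : (c i l < (Num.truncn h^-1).+1)%N by rewrite ltnS cell_le.
pose y : J := [ffun l => Ordinal (yP l)].
have yE l : y l = c i l :> nat by rewrite ffunE.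
have toW (S : {set 'I_n}) (lo hi : 'I_d -> nat) : (forall q, q \in S -> forall l,
   (c i l <= c q l + lo l)%N && (c q l <= c i l + hi l)%N) ->
   (#|S| <= #|[set q | `[< window h (fun l => y l) lo hi (X q w) >]]%SET|)%N.
  move=> HS; apply: subset_leq_card; apply/fintype.subsetP => q qS; rewrite inE.
  by apply/asboolP; apply: cell_window => // l; rewrite yE; exact: HS.
apply: nF; rewrite -bigcup_pred; exists y; first by rewrite /= inE.
have [_ _ ] := FP y; apply.
case: H => [H|[H1 H2]]; [left|right].
  by apply: leq_trans H _; apply: toW => q; rewrite inE => /forallP.
split; first by apply: leq_trans H1 _; apply: toW => q; rewrite inE => /forallP.
case: H2 => H2; [left|right]; apply: leq_trans H2 _; apply: toW => q;
  rewrite !inE => /andP[/forallP Niq Qiq] l; have := Niq l;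
  by rewrite /near_reach /half_reach; case: eqP => [->|_] //; move: Qiq; lia.
Qed.

End Clusters.

(** * Elementary estimates *)

Section Estimates.
Context {R : realType}.
Implicit Types (x M A p : R) (n m k e f : nat).

Lemma binomial_power_le n m p : 0 <= p ->
  'C(n, m)%:R * p ^+ m <= (n%:R * p) ^+ m / m`!%:R.
Proof.
move=> p0; rewrite ler_pdivlMr ?ltr0n ?fact_gt0 // mulrAC exprMn.
apply: ler_wpM2r; first exact: exprn_ge0.
rewrite -natrM bin_ffact -natrX ler_nat.
elim: m => [|m IH] //; rewrite ffactnSr expnSr.
by apply: leq_mul => //; exact: leq_subr.
Qed.

(** The term of index f in the expansion of (1 + 1/8)^k.  For f much smaller than
    k the bound grows slowly with k, unlike 2^k. *)
Lemma binomial_exponential_le k f : 'C(k, f)%:R <= (9 / 8) ^+ k * 8 ^+ f :> R.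
Proof.
case: (leqP f k) => fk; last first.
  by rewrite bin_small //; apply: mulr_ge0; apply: exprn_ge0; lra.
have -> : 'C(k, f)%:R = 'C(k, f)%:R * 8^-1 ^+ f * 8 ^+ f :> R.
  by rewrite -mulrA -exprMn mulVf ?expr1n ?mulr1.
apply: ler_wpM2r; first exact: exprn_ge0.
have -> : 9 / 8 = 1 + 8^-1 :> R by field.
rewrite exprDn (bigD1 (inord f)) //=.
by rewrite inordK // expr1n mul1r mulr_natl lerDl sumr_ge0.
Qed.

Lemma fact_shift k e : (k`! * k ^ e <= (k + e)`!)%N.
Proof.
elim: e => [|e IH]; first by rewrite expn0 muln1 addn0.
rewrite addnS factS expnSr mulnA mulnC; apply: leq_mul => //.
by rewrite -addnS leq_addr.
Qed.

Lemma bernoulli_upper x m : 0 <= x -> (1 + x) ^+ m * (1 - m%:R * x) <= 1.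
Proof.
move=> x0; elim: m => [|m IH]; first by rewrite expr0 mul0r subr0 mul1r.
apply: le_trans IH; rewrite exprSr -mulrA; apply: ler_wpM2l.
  by rewrite exprn_ge0 // addr_ge0.
rewrite -natr1; have := mulr_ge0 (ler0n R m) (sqr_ge0 x); have := sqr_ge0 x; lra.
Qed.

Lemma bernoulli_lower x m : 0 <= x -> 1 + m%:R * x <= (1 + x) ^+ m.
Proof.
move=> x0; elim: m => [|m IH]; first by rewrite expr0 mul0r addr0.
rewrite exprSr -natr1; apply: le_trans (ler_wpM2r _ IH); last by rewrite addr_ge0.
by have := mulr_ge0 (ler0n R m) (sqr_ge0 x); lra.
Qed.

(** Once k >= 2 M^W, the quotient is at most 2^(-e), and e >= k/W. *)
Lemma superexponential_decay A M (W : nat) : 0 <= A -> 1 <= M ->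
  forall eps, 0 < eps -> exists k0, forall k e, (k0 <= k)%N -> (k <= W * e)%N ->
    A * (M ^+ k / k%:R ^+ e) <= eps.
Proof.
move=> A0 M1 eps eps0.
exists (Num.truncn (2 * M ^+ W) + Num.truncn (A * W%:R / eps)).+1 => k e k0k kWe.
have k1 : 2 * M ^+ W <= k%:R.
  apply/ltW/(lt_le_trans (Num.Theory.truncnS_gt _)); rewrite ler_nat.
  by apply: leq_trans k0k; rewrite ltnS leq_addr.
have k2 : A * W%:R / eps <= k%:R.
  apply/ltW/(lt_le_trans (Num.Theory.truncnS_gt _)); rewrite ler_nat.
  by apply: leq_trans k0k; rewrite ltnS leq_addl.
have kpos : 0 < k%:R :> R by rewrite ltr0n; exact: leq_ltn_trans k0k.
have MW : 0 < M ^+ W by rewrite exprn_gt0 //; lra.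
have h1 : M ^+ k / k%:R ^+ e <= (2^-1) ^+ e.
  rewrite ler_pdivrMr ?exprn_gt0 // -exprMn.
  apply: le_trans (_ : (M ^+ W) ^+ e <= _).
    by rewrite -exprM; apply: ler_weXn2l.
  by apply: lerXn2r; rewrite ?nnegrE; lra.
apply: le_trans (ler_wpM2l A0 h1) _.
rewrite exprVn ler_pdivrMr ?exprn_gt0 //.
have h2 : e%:R <= 2 ^+ e :> R.
  by have := bernoulli_lower 1 e ler01; rewrite mulr1 => /(le_trans _); apply; lra.
have h3 : k%:R <= W%:R * e%:R :> R by rewrite -natrM ler_nat.
case: (posnP W) => [W0|Wpos].
  by move: kWe k0k; rewrite W0 mul0n leqn0 => /eqP ->.
have W1 : 0 < W%:R :> R by rewrite ltr0n.
rewrite -(ler_pM2r W1).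
apply: le_trans (_ : eps * k%:R <= _).
  by rewrite [eps * _]mulrC -ler_pdivrMr.
rewrite -mulrA ler_pM2l //; nra.
Qed.

(** The factor k + 1 is at most 100 (101/100)^k, and (101/100) (49/50) < 99/100. *)
Lemma geometric_decay A : 0 <= A ->
  forall eps, 0 < eps -> exists k0, forall k, (k0 <= k)%N ->
    A * ((k%:R + 1) * (49 / 50) ^+ k) <= eps.
Proof.
move=> A0 eps eps0.
have : (100 * A) * (99 / 100) ^+ k @[k --> \oo] --> 100 * A * 0.
  by apply: cvgMr; apply: cvg_expr; rewrite ger0_norm; lra.
rewrite mulr0 => /cvgrPdist_lt/(_ _ eps0)[k0 _ H].
exists k0 => k /H /=; rewrite sub0r normrN => /ltW; apply: le_trans.
apply: le_trans (ler_norm _); rewrite [100 * A]mulrC -[leRHS]mulrA.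
apply: ler_wpM2l => //.
apply: le_trans (_ : 100 * (101 / 100) ^+ k * (49 / 50) ^+ k <= _).
  apply: ler_wpM2r; first by apply: exprn_ge0; lra.
  have -> : 101 / 100 = 1 + 1 / 100 :> R by field.
  by have := bernoulli_lower (1 / 100) k; lra.
rewrite -mulrA -exprMn; apply: ler_wpM2l => //.
by apply: lerXn2r; rewrite ?nnegrE; lra.
Qed.

End Estimates.

Section Rates.
Context {R : realType}.

(** The ratio of confined to full windows is close to 3/4, and rounding to the
    grid enlarges volumes by a factor close to 1, because L is large compared
    with d; the constant 96/95 comes from Bernoulli's inequality at 1/(3L). *)
Lemma half_window_ratio (d L : nat) : L = (32 * d.+1)%N ->
  3 / 4 <= (3 * L + 1)%:R / (4 * L + 1)%:R :> R /\
  ((4 * L + 1)%:R / (4 * L)%:R) ^+ d * ((3 * L + 1)%:R / (4 * L + 1)%:R)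
    <= 3 / 4 * (96 / 95) :> R.
Proof.
move=> LE; have L0 : 0 < L%:R :> R by rewrite ltr0n LE.
have -> : (3 * L + 1)%:R = 3 * L%:R + 1 :> R by rewrite natrD natrM.
have -> : (4 * L + 1)%:R = 4 * L%:R + 1 :> R by rewrite natrD natrM.
rewrite natrM; split; first by rewrite ler_pdivlMr; lra.
set x : R := (3 * L%:R)^-1.
have x0 : 0 < x by rewrite /x invr_gt0; lra.
have xL : x * (3 * L%:R) = 1 :> R.
  by rewrite /x mulVf // mulf_neq0 // gt_eqF.
have h1 : (3 * L%:R + 1) / (4 * L%:R + 1) <= 3 / 4 * (1 + x) :> R.
  rewrite ler_pdivrMr; last lra.
  have -> : 3 * L%:R + 1 = (3 * L%:R) * (1 + x) :> R by rewrite mulrDr mulr1 [_ * x]mulrC xL.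
  by rewrite [leRHS]mulrAC ler_pM2r; lra.
have h2 : (4 * L%:R + 1) / (4 * L%:R) <= 1 + x :> R.
  by rewrite ler_pdivrMr; nra.
have h3 : (1 + x) ^+ d.+1 <= 96 / 95 :> R.
  have := @bernoulli_upper R x d.+1 (ltW x0).
  have -> : d.+1%:R * x = 1 / 96 :> R.
    move: xL; rewrite LE natrM => xL.
    lra.
  lra.
apply: le_trans (_ : (1 + x) ^+ d * (3 / 4 * (1 + x)) <= _).
  apply: ler_pM => //.
  by apply: lerXn2r => //; rewrite nnegrE //; lra.
by rewrite mulrCA -exprSr; lra.
Qed.

(** The base is 3/4 * (96/95) * (51/50) * (9/8)^2 < 49/50.  One factor 9/8 is the
    growth of the binomial coefficient, and the other one absorbs 16^f, since
    24 f <= k and 16 <= (9/8)^24. *)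
Lemma half_window_rate (k f : nat) (kappa tau q : R) : (24 * f <= k)%N ->
  3 / 4 <= tau -> 0 <= kappa -> kappa * tau <= 3 / 4 * (96 / 95) ->
  0 <= q <= 51 / 50 ->
  (kappa * q) ^+ k * ('C(k, k - f)%:R * tau ^+ (k - f)) <= (49 / 50) ^+ k.
Proof.
move=> fk tau34 kappa0 kt /andP[q0 q1].
have fk' : (f <= k)%N by lia.
have tau0 : 0 <= tau by lra.
have [a aE] : exists a : R, a = 9 / 8 by eexists.
have a1 : 1 <= a by lra.
(* 8 * (4/3) <= 16 bounds the cost of each of the f points that are not
   confined *)
have h16 : 16 <= a ^+ 24.
  have h4 : 8 / 5 <= a ^+ 4 by rewrite aE !exprS expr0; lra.
  rewrite (exprM _ 4 6); apply: le_trans (_ : (8 / 5) ^+ 6 <= _).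
    by rewrite !exprS expr0; lra.
  by apply: lerXn2r; rewrite ?nnegrE ?exprn_ge0; lra.
have hb : 'C(k, k - f)%:R * tau ^+ (k - f) <= (a * a * tau) ^+ k.
  rewrite bin_sub //.
  apply: le_trans (_ : a ^+ k * 8 ^+ f * (tau ^+ k * (4 / 3) ^+ f) <= _).
    apply: ler_pM; rewrite ?ler0n ?exprn_ge0 //.
      by rewrite aE; exact: binomial_exponential_le.
    rewrite -{2}(subnK fk') exprD -mulrA -exprMn.
    rewrite -[leLHS]mulr1; apply: ler_wpM2l; first exact: exprn_ge0.
    by apply: exprn_ege1; lra.
  have -> : a ^+ k * 8 ^+ f * (tau ^+ k * (4 / 3) ^+ f) =
      a ^+ k * tau ^+ k * (8 * (4 / 3)) ^+ f by rewrite [(8 * _) ^+ f]exprMn; ring.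
  have -> : (a * a * tau) ^+ k = a ^+ k * tau ^+ k * a ^+ k by rewrite !exprMn; ring.
  apply: ler_wpM2l; first by rewrite mulr_ge0 // exprn_ge0 //; lra.
  apply: le_trans (_ : 16 ^+ f <= _); first by apply: lerXn2r; rewrite ?nnegrE; lra.
  apply: le_trans (_ : (a ^+ 24) ^+ f <= _).
    by apply: lerXn2r; rewrite ?nnegrE ?exprn_ge0; lra.
  by rewrite -exprM; apply: ler_weXn2l.
rewrite aE in hb.
apply: le_trans (ler_wpM2l _ hb) _; first by rewrite exprn_ge0 // mulr_ge0.
rewrite -exprMn; apply: lerXn2r; rewrite ?nnegrE; first by rewrite !mulr_ge0 //; lra.
  lra.
have : kappa * tau * q <= 3 / 4 * (96 / 95) * (51 / 50).
  by apply: ler_pM => //; exact: mulr_ge0.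
lra.
Qed.

End Rates.

(** * The probability of the exceptional event *)

Section ClusterBound.
Context {R : realType}.
Variables (d n k e t : nat) (gamma delta : R).
Let L := (32 * d.+1)%N.
Let h := delta / (4 * L)%:R.
Let g := delta ^+ d * n%:R.
Let ncells := (Num.truncn h^-1).+1%:R ^+ d : R.

(** Comes from the number of cells, at most (8 L / delta)^d, which is of order n,
    and from the threshold condition on n gamma^(k+1) / (k+1)!. *)
Definition prefactor : R := (8 * L)%:R ^+ d * (2 / gamma) * (expR gamma / gamma).
(** An upper bound for n times the volume of the window of far_reach, valid since
    n delta^d <= 2 gamma. *)
Definition far_base : R := ((8 * L + 1)%:R / (4 * L)%:R) ^+ d * (2 * gamma).
Definition far_rate : R :=
  Num.max 1 (2 * gamma^-1 * Num.max 1 far_base ^+ 2).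

Hypotheses (gamma_gt0 : 0 < gamma) (delta_gt0 : 0 < delta) (h_le1 : h <= 1).
Hypotheses (g_ge : gamma / 2 <= g) (g_le : g <= 51 / 50 * gamma).
Hypothesis tail : n%:R * (gamma ^+ k.+1 / k.+1`!%:R * expR (- gamma)) <= 1.

Let L_gt0 : 0 < (4 * L)%:R :> R. Proof. by rewrite ltr0n. Qed.
Let h_gt0 : 0 < h. Proof. exact: divr_gt0. Qed.
Let D_gt0 : 0 < delta ^+ d. Proof. exact: exprn_gt0. Qed.

Lemma ncells_le : ncells <= (8 * L)%:R ^+ d * (2 / gamma) * n%:R.
Proof.
have hK : (Num.truncn h^-1).+1%:R <= (8 * L)%:R / delta.
  have h1 : 1 <= h^-1 by rewrite invf_ge1.
  have -> : (8 * L)%:R / delta = 2 * h^-1.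
    rewrite /h invf_div mulrA; congr (_ / _).
    by rewrite -natrM mulnA.
  have : (Num.truncn h^-1)%:R <= h^-1 by rewrite truncn_le invr_ge0 ltW.
  by rewrite -natr1; lra.
have : ncells <= ((8 * L)%:R / delta) ^+ d.
  by apply: lerXn2r => //; rewrite nnegrE ?divr_ge0 // ltW.
move=> /le_trans; apply; rewrite expr_div_n -[leRHS]mulrA.
apply: ler_wpM2l; first exact: exprn_ge0.
rewrite -(ler_pM2r D_gt0) mulVf ?gt_eqF //.
have -> : 2 / gamma * n%:R * delta ^+ d = 2 * g / gamma by rewrite /g; ring.
by rewrite ler_pdivlMr // mul1r; move: g_ge; rewrite /g; lra.
Qed.

(** There are about n cells, and the threshold condition bounds
    n gamma^k / k!. *)
Lemma ncells_poisson : ncells * (gamma ^+ k / k`!%:R) <= prefactor * (k%:R + 1).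
Proof.
have w0 : 0 <= gamma ^+ k / k`!%:R by rewrite divr_ge0 // exprn_ge0 // ltW.
apply: le_trans (ler_wpM2r w0 ncells_le) _.
rewrite /prefactor -[leLHS]mulrA -[leRHS]mulrA; apply: ler_wpM2l.
  by apply: mulr_ge0; [exact: exprn_ge0 | rewrite divr_ge0 // ltW].
move: tail; rewrite expRN factS natrM -natr1 exprSr => tl.
have f0 : 0 < k`!%:R :> R by rewrite ltr0n fact_gt0.
have k0 : 0 < k%:R + 1 :> R by rewrite ltr_wpDl.
have e0 := expR_gt0 gamma.
have c0 : 0 < expR gamma / gamma * (k%:R + 1) by rewrite mulr_gt0 // divr_gt0.
rewrite -[leRHS]mulr1 -ler_pdivrMl // mulrC.
apply: le_trans tl; rewrite le_eqVlt; apply/orP; left; apply/eqP.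
by field; rewrite !gt_eqF.
Qed.

(** The e additional points divide the bound by (k + e)! / k! >= k^e. *)
Lemma far_term_le : (0 < k)%N -> (e <= k)%N ->
  ncells * ('C(n, k + e)%:R * @prob_far R d h L ^+ (k + e)) <=
  prefactor * (far_rate ^+ k / k%:R ^+ e).
Proof.
move=> k0 ek.
have f0 : 0 < k`!%:R :> R by rewrite ltr0n fact_gt0.
have k0R : 0 < k%:R :> R by rewrite ltr0n.
have nc0 : 0 <= ncells by exact: exprn_ge0.
have pf0 : 0 <= @prob_far R d h L.
  by apply: exprn_ge0; apply: mulr_ge0 => //; exact: ltW.
have C0 : 0 <= prefactor.
  have := expR_ge0 gamma; rewrite /prefactor => ?.
  by rewrite !mulr_ge0 ?exprn_ge0 ?invr_ge0 // ltW.
set B := Num.max 1 far_base.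
have B1 : 1 <= B by rewrite le_max lexx.
have farB : n%:R * @prob_far R d h L <= B.
  apply: le_trans (_ : far_base <= _); last by rewrite le_max lexx orbT.
  rewrite /prob_far /far_base /h.
  have -> : n%:R * ((8 * L + 1)%:R * (delta / (4 * L)%:R)) ^+ d =
     ((8 * L + 1)%:R / (4 * L)%:R) ^+ d * g.
    by rewrite /g mulrCA !expr_div_n !exprMn !exprVn; ring.
  apply: ler_wpM2l; last by move: g_le gamma_gt0; rewrite /g; lra.
  by rewrite exprn_ge0 // divr_ge0 // ltW.
have step1 : 'C(n, k + e)%:R * @prob_far R d h L ^+ (k + e) <=
    (B ^+ 2) ^+ k / (k`!%:R * k%:R ^+ e).
  apply: le_trans (binomial_power_le _ _ _ pf0) _.
  apply: ler_pM.
  - by rewrite exprn_ge0 // mulr_ge0.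
  - by rewrite invr_ge0.
  - apply: le_trans (_ : B ^+ (k + e) <= _).
      by apply: lerXn2r => //; rewrite nnegrE ?mulr_ge0 //; lra.
    by rewrite -exprM; apply: ler_weXn2l => //; rewrite mul2n -addnn leq_add2l.
  - rewrite lef_pV2 ?posrE ?mulr_gt0 ?exprn_gt0 ?ltr0n ?fact_gt0 //.
    by rewrite -natrX -natrM ler_nat fact_shift.
apply: le_trans (ler_wpM2l nc0 step1) _.
have -> : ncells * ((B ^+ 2) ^+ k / (k`!%:R * k%:R ^+ e)) =
   ncells * (gamma ^+ k / k`!%:R) * ((gamma^-1 * B ^+ 2) ^+ k / k%:R ^+ e).
  rewrite [(gamma^-1 * _) ^+ k]exprMn [gamma^-1 ^+ k]exprVn; field.
  by rewrite !gt_eqF // exprn_gt0.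
have r0 : 0 <= (gamma^-1 * B ^+ 2) ^+ k / k%:R ^+ e.
  by rewrite divr_ge0 ?exprn_ge0 // mulr_ge0 ?exprn_ge0 ?invr_ge0 ?ltW //; lra.
apply: le_trans (ler_wpM2r r0 ncells_poisson) _.
rewrite -mulrA; apply: ler_wpM2l => //.
rewrite mulrA; apply: ler_wpM2r; first by rewrite invr_ge0 exprn_ge0.
apply: le_trans (_ : 2 ^+ k * (gamma^-1 * B ^+ 2) ^+ k <= _).
  apply: ler_wpM2r.
    by rewrite exprn_ge0 // mulr_ge0 ?exprn_ge0 ?invr_ge0 ?ltW //; lra.
  by have := @bernoulli_lower R 1 k ler01; lra.
rewrite -exprMn mulrA; apply: lerXn2r; rewrite ?nnegrE.
- by rewrite !mulr_ge0 ?invr_ge0 ?exprn_ge0 // ltW //; lra.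
- by rewrite le_max ler01.
- by rewrite /far_rate le_max lexx orbT.
Qed.

(** Without confinement the expected number of windows with k points is at most
    of order k + 1; confining most of the k points makes it exponentially small. *)
Lemma near_term_le : (24 * (t * e) <= k)%N ->
  ncells * ('C(n, k)%:R * ('C(k, k - t * e)%:R *
   (@prob_half R d h L ^+ (k - t * e) * @prob_near R d h L ^+ (k - (k - t * e))))) <=
  prefactor * ((k%:R + 1) * (49 / 50) ^+ k).
Proof.
move=> fk; set s := (k - t * e)%N.
have sk : (s <= k)%N by exact: leq_subr.
have nc0 : 0 <= ncells by exact: exprn_ge0.
have C0 : 0 <= prefactor.
  have := expR_ge0 gamma; rewrite /prefactor => ?.
  by rewrite !mulr_ge0 ?exprn_ge0 ?invr_ge0 // ltW.
have f0 : 0 < k`!%:R :> R by rewrite ltr0n fact_gt0.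
have pn0 : 0 <= @prob_near R d h L.
  by apply: exprn_ge0; apply: mulr_ge0 => //; exact: ltW.
set tau : R := (3 * L + 1)%:R / (4 * L + 1)%:R.
set kappa : R := ((4 * L + 1)%:R / (4 * L)%:R) ^+ d.
have [tau34 kt] : 3 / 4 <= tau /\ kappa * tau <= 3 / 4 * (96 / 95).
  exact: half_window_ratio.
have kappa0 : 0 <= kappa by rewrite exprn_ge0 // divr_ge0 // ltW.
have tau0 : 0 <= tau by lra.
have nearE : n%:R * @prob_near R d h L = kappa * g.
  by rewrite /prob_near /h /kappa /g !exprMn; ring.
have -> : @prob_half R d h L ^+ s * @prob_near R d h L ^+ (k - s) =
   tau ^+ s * @prob_near R d h L ^+ k.
  by rewrite /prob_half -/tau exprMn -mulrA -exprD subnKC.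
have h1 := binomial_power_le n k _ pn0; rewrite nearE in h1.
have u0 : 0 <= 'C(k, s)%:R * tau ^+ s by rewrite mulr_ge0 // exprn_ge0.
have -> : ncells * ('C(n, k)%:R * ('C(k, s)%:R * (tau ^+ s * @prob_near R d h L ^+ k)))
  = ncells * (('C(n, k)%:R * @prob_near R d h L ^+ k) * ('C(k, s)%:R * tau ^+ s)).
  by ring.
apply: le_trans (ler_wpM2l nc0 (ler_wpM2r u0 h1)) _.
have -> : ncells * ((kappa * g) ^+ k / k`!%:R * ('C(k, s)%:R * tau ^+ s)) =
   ncells * (gamma ^+ k / k`!%:R) *
   ((kappa * (g / gamma)) ^+ k * ('C(k, s)%:R * tau ^+ s)).
  rewrite [(kappa * g) ^+ k]exprMn [(kappa * (g / gamma)) ^+ k]exprMn.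
  rewrite [(g / gamma) ^+ k]expr_div_n.
  move: (kappa ^+ k) (g ^+ k) (tau ^+ s) => x y z; field.
  by rewrite !gt_eqF // exprn_gt0.
have q01 : 0 <= g / gamma <= 51 / 50.
  apply/andP; split; last by rewrite ler_pdivrMr.
  by apply: divr_ge0; [move: g_ge gamma_gt0; rewrite /g; lra | exact: ltW].
have rate := half_window_rate k (t * e) kappa tau (g / gamma) fk tau34 kappa0 kt q01.
have p0 : 0 <= ncells * (gamma ^+ k / k`!%:R).
  by rewrite mulr_ge0 // divr_ge0 ?exprn_ge0 // ltW.
apply: le_trans (ler_wpM2l p0 rate) _.
rewrite [leRHS]mulrA; apply: ler_wpM2r; last exact: ncells_poisson.
by apply: exprn_ge0; lra.
Qed.

Lemma cluster_bound_le : (0 < k)%N -> (e <= k)%N -> (24 * (t * e) <= k)%N ->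
  ncells * @cluster_bound R d h L n k e t <=
  prefactor * (far_rate ^+ k / k%:R ^+ e) +
  2 * prefactor * ((k%:R + 1) * (49 / 50) ^+ k).
Proof.
move=> k0 ek fk; rewrite /cluster_bound mulrDr; apply: lerD.
  exact: far_term_le.
by rewrite mulrCA -[leRHS]mulrA; apply: ler_wpM2l => //; exact: near_term_le.
Qed.

End ClusterBound.

(** * The Poisson threshold *)

Section Poisson.
Context {R : realType}.

Lemma poisson_set_ge (gamma : R) (A : set nat) (m : nat) : 0 < gamma -> A m ->
  ((gamma ^+ m / m`!%:R * expR (- gamma))%:E <= Po gamma A)%E.
Proof.
move=> g0 Am.
have -> : (gamma ^+ m / m`!%:R * expR (- gamma))%:E = Po gamma [set m].
  rewrite /Po /= /poisson_prob g0 esum_set1 ?lee_fin ?poisson_pmf_ge0 //.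
  by rewrite /poisson_pmf g0.
by apply: le_measure; rewrite ?inE // => x ->.
Qed.

Lemma threshold_tail (gamma : R) (n k : nat) : 0 < gamma ->
  (n%:R%:E * Po gamma [set m | (k + 1 <= m)%N] <= 1)%E ->
  n%:R * (gamma ^+ k.+1 / k.+1`!%:R * expR (- gamma)) <= 1.
Proof.
move=> g0 H; rewrite -lee_fin EFinM; apply: le_trans H.
by apply: lee_wpmul2l; rewrite ?lee_fin //; apply: poisson_set_ge => //=; rewrite addn1.
Qed.

(** If j n < J, then n P(Po(gamma) >= J) <= 1, which bounds n. *)
Lemma threshold_diverges (gamma : R) (j : nat -> nat) : 0 < gamma ->
  (forall n, (2 <= n)%N ->
    (n%:R%:E * Po gamma [set m | (j n + 1 <= m)%N] <= 1)%E) ->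
  forall J : nat, \forall n \near \oo, (J <= j n)%N.
Proof.
move=> g0 hj J.
pose p := gamma ^+ J / J`!%:R * expR (- gamma).
have p0 : 0 < p.
  by rewrite mulr_gt0 ?expR_gt0 // divr_gt0 ?exprn_gt0 // ltr0n fact_gt0.
exists (maxn 2 (Num.truncn p^-1).+1) => // n /= ; rewrite geq_max => /andP[n2 np].
rewrite leqNgt; apply/negP => jJ.
have : n%:R * p <= 1.
  rewrite -lee_fin EFinM; apply: le_trans (hj n n2).
  by apply: lee_wpmul2l; rewrite ?lee_fin //; apply: poisson_set_ge => //=; rewrite addn1.
rewrite -ler_pdivlMr // div1r leNgt => /negP; apply.
by apply: lt_le_trans (truncnS_gt _) _; rewrite ler_nat.
Qed.

End Poisson.

(** * Eigenvalues of the rescaled Euclidean random matrix *)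

Section EuclideanMatrix.
Context {R : realType} {d : nat}.
Variables (f : 'rV[R]_d -> R[i]) (delta : R).
Hypothesis delta_gt0 : 0 < delta.

(** Uses that the cube is symmetric of half-side 1/2. *)
Lemma rescale_support (x : 'rV[R]_d) : closure [set x | f x != 0] `<=` @Omega R d ->
  rescale f delta x != 0 -> forall l, `|x ord0 l| <= delta / 2.
Proof.
move=> suppf fx l.
have /(_ l) : @Omega R d (delta^-1 *: x) by apply: suppf; exact: subset_closure.
rewrite mxE => /andP[h1 h2].
have xE : x ord0 l = delta * (delta^-1 * x ord0 l) by rewrite mulrA mulfV ?mul1r // gt_eqF.
rewrite xE normrM gtr0_norm // ler_pM2l //.
by rewrite ler_norml h1 h2.
Qed.

Lemma rescale_le_sup (s : R) (x : 'rV[R]_d) :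
  closure [set x | f x != 0] `<=` @Omega R d ->
  ereal_sup [set (Normc.normc (f x))%:E | x in @Omega R d] = s%:E -> 0 <= s ->
  Normc.normc (rescale f delta x) <= s.
Proof.
move=> suppf sE s0; have [->|fx] := eqVneq (rescale f delta x) 0.
  by rewrite Normc.normc0.
rewrite -lee_fin -sE; apply: ereal_sup_ubound; exists (delta^-1 *: x) => //.
by apply: suppf; exact: subset_closure.
Qed.

Context {disp : measure_display} {T : measurableType disp} (P : probability T R).

Lemma measurable_euclidean_entry (n : nat) (X : 'I_n -> {RV P >-> 'rV[R]_d}) i j :
  complex_measurable f ->
  complex_measurable
    (fun w => euclidean_matrix (rescale f delta) (fun i => X i w) i j).
Proof.
move=> [f1 f2].
have mX : measurable_fun setT (fun w => delta^-1 *: (X i w - X j w)).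
  apply: measurable_fun_rV => l.
  rewrite (_ : (fun _ => _) = fun w => delta^-1 * (X i w ord0 l - X j w ord0 l)).
    apply: measurable_funM => //; apply: measurable_funB.

      exact: (measurableT_comp (measurable_coord d l) (measurable_funPT (X i))).
    exact: (measurableT_comp (measurable_coord d l) (measurable_funPT (X j))).
  by apply/funext => w; rewrite !mxE.
by split; under eq_fun do rewrite mxE;
  [exact: (measurableT_comp f1 mX) | exact: (measurableT_comp f2 mX)].
Qed.

End EuclideanMatrix.

Theorem proposition4 (R : realType) (d : nat) (hd : (2 <= d)%N)
  (f : 'rV[R]_d -> R[i]) (mf : complex_measurable f)
  (suppf : closure [set x | f x != 0] `<=` @Omega R d)
  (gamma : R) (hgamma : 0 < gamma)
  (delta : nat -> R) (delta_gt0 : forall n, 0 < delta n)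
  (delta_cvg0 : delta n @[n --> \oo] --> (0 : R))
  (delta_gamma : delta n ^+ d * n%:R @[n --> \oo] --> gamma)
  (disp : measure_display) (T : measurableType disp) (P : probability T R)
  (X : forall n : nat, 'I_n -> {RV P >-> 'rV[R]_d})
  (X_unif : forall (n : nat) (i : 'I_n),
     uniformly_distributed (X n i) (@Omega R d))
  (X_indep : forall n : nat, independent_RVs (X n))
  (lam : forall n : nat, T -> 'I_n -> R[i])
  (lam_eig : forall (n : nat) (w : T),
     eigenvalues_of
       (euclidean_matrix (rescale f (delta n)) (fun i => X n i w)) (lam n w))
  (j : nat -> nat)
  (hj : forall n : nat, (2 <= n)%N ->
     (n%:R%:E * Po gamma [set k | (j n + 1 <= k)%N] <= 1)%E /\
     (1 < n%:R%:E * Po gamma [set k | (j n <= k)%N])%E) :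
  P [set w | ((\big[Num.max/0]_(i < n) Normc.normc (lam n w i))%:E <=
      (j n)%:R%:E *
        ereal_sup [set (Normc.normc (f x))%:E | x in @Omega R d])%E]
    @[n --> \oo] --> (1 : \bar R)%E.
Proof.
have tail n : (2 <= n)%N -> (n%:R%:E * Po gamma [set k | (j n + 1 <= k)%N] <= 1)%E.
  by move=> /hj[].
have jdiv := threshold_diverges gamma j hgamma tail.
set S := ereal_sup _.
have S0 : (0 <= S)%E.
  apply: le_trans (_ : (Normc.normc (f 0))%:E <= _)%E.
    by rewrite lee_fin normc_ge0.
  apply: ereal_sup_ubound; exists 0 => // l; rewrite mxE; lra.
pose E n := [set w | ((\big[Num.max/0]_(i < n) Normc.normc (lam n w i))%:E <=
      (j n)%:R%:E * S)%E].
rewrite -/(E _).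
move: S0 @E; case SE : S => [s||] // S0 E; last first.
  have ET : \forall n \near \oo, P (E n) = 1%E.
    near=> n; rewrite (_ : E n = setT) ?probability_setT //.
    apply/seteqP; split => // w _; rewrite /E /= gt0_muley ?leey //.
    rewrite lte_fin ltr0n; near: n; exact: jdiv 1%N.
  apply: cvg_near_cst; exact: ET.
have s0 : 0 <= s by rewrite -lee_fin.
have EE n : E n = [set w | forall i, Normc.normc (lam n w i) <= (j n)%:R * s].
  apply/seteqP; split => w; rewrite /E /= -EFinM lee_fin.
    by move=> /bigmax_leP[_ H] i; exact: H.
  by move=> H; apply/bigmax_leP; split => [|i _]; [exact: mulr_ge0 | exact: H].
have mE n : measurable (E n).
  rewrite EE; apply: (@measurable_spectral_radius_le _ _ _ n _ (lam n) _ _ (lam_eig n)).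
  by move=> i l; exact: measurable_euclidean_entry.
have main : forall eps, 0 < eps -> \forall n \near \oo, (P (~` E n) <= eps%:E)%E.
  move=> eps eps0.
  have C0 : 0 <= prefactor d gamma.
    have := expR_ge0 gamma; rewrite /prefactor => ?.
    by rewrite !mulr_ge0 ?exprn_ge0 ?invr_ge0 // ltW.
  have eps2 : 0 < eps / 2 by lra.
  (* t = 49 and e just above k / (49 * 48) satisfy k <= t (t - 1) e and, for k
     large, 24 t e <= k *)
  have [k1 Hk1] := @superexponential_decay R (prefactor d gamma) (far_rate d gamma)
    (49 * 48) C0 (ltac:(by rewrite /far_rate le_max lexx)) (eps / 2) eps2.
  have [k2 Hk2] := @geometric_decay R (2 * prefactor d gamma)
    (mulr_ge0 (ler0n _ 2) C0) (eps / 2) eps2.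
  near=> n.
  have n2 : (2 <= n)%N by near: n; exact: nbhs_infty_ge.
  pose L := (32 * d.+1)%N; pose h := delta n / (4 * L)%:R.
  have jk1 : (k1 <= j n)%N by near: n; exact: jdiv.
  have jk2 : (k2 <= j n)%N by near: n; exact: jdiv.
  have jW : (49 * 48 <= j n)%N by near: n; exact: jdiv.
  have gn : `|gamma - delta n ^+ d * n%:R| <= gamma / 50.
    near: n; move/cvgrPdist_le : delta_gamma; apply; lra.
  have dn : `|0 - delta n| <= 1.
    near: n; move/cvgrPdist_le : delta_cvg0; apply; lra.
  pose e := ((j n %/ (49 * 48)).+1)%N.
  have L4 : 1 <= (4 * L)%:R :> R by rewrite ler1n.
  have h0 : 0 < h by rewrite divr_gt0 //; lra.
  have h1 : h <= 1.
    rewrite ler_pdivrMr; last lra.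
    rewrite mul1r; apply: le_trans L4; apply: le_trans dn.
    by rewrite sub0r normrN; exact: ler_norm.
  have ke : (j n <= 49 * (49 - 1) * e)%N.
    by rewrite mulnC; apply: ltnW; exact: ltn_ceil.
  have [fe ek] : (24 * (49 * e) <= j n)%N /\ (e <= j n)%N.
    have := leq_divM (j n) (49 * 48); move: jW; rewrite /e.
    by move: (j n %/ (49 * 48))%N (j n) => q k; lia.
  have j0 : (0 < j n)%N by apply: leq_trans jW.
  have l0 : 'I_d := Ordinal (leq_trans (ltn0Sn 1) hd).
  have [F [mF PF FP]] := cluster_event l0 P h L h0 n (X n) (X_unif n) (X_indep n)
    (j n) e 49 (ltac:(by [])) ke.
  apply: le_trans (_ : P F <= _)%E.
    apply: le_measure; [exact/mem_set/measurableC | exact: mem_set |].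
    move=> w /= nE; apply: contrapT => /FP small; apply: nE; rewrite EE /=.
    apply: (@eigenvalue_le_rows _ n _ (lam n w) (fun p q => [forall l,
       `|X n q w ord0 l - X n p w ord0 l| <= (2 * L)%:R * h]) s (j n)
       (lam_eig n w) s0) => //.
      by move=> q p; rewrite mxE; exact: rescale_le_sup.
    move=> q p; rewrite mxE => pq; apply/eqP; apply: contraR pq => /rescale_support supp_pq.
    apply/forallP => l; have := supp_pq (delta_gt0 n) suppf l; rewrite !mxE.
    move=> /le_trans; apply; rewrite le_eqVlt /h; apply/orP; left; apply/eqP.
    have -> : (4 * L)%:R = 2 * (2 * L)%:R :> R by rewrite -natrM mulnA.
    have : (2 * L)%:R != 0 :> R by rewrite pnatr_eq0.
    by move: (2 * L)%:R => y y0; field.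
  apply: le_trans PF _; rewrite lee_fin.
  move: gn; rewrite ler_norml => /andP[gn1 gn2].
  apply: le_trans (cluster_bound_le d n (j n) e 49 gamma (delta n) hgamma
    (delta_gt0 n) h1 _ _ _ j0 ek fe) _; [lra|lra| |].
    by apply: threshold_tail => //; exact: tail.
  rewrite (splitr eps); apply: lerD; [apply: Hk1 => //|exact: Hk2].
apply/fine_cvgP; split.
  by near=> n; apply: fin_num_measure; exact: mE.
apply/cvgrPdist_le => eps eps0; near=> n => /=.
have : (P (~` E n) <= eps%:E)%E by near: n; exact: main.
rewrite probability_setC //.
have : P (E n) \is a fin_num by apply: fin_num_measure.
have := probability_le1 P (mE n).
case: (P (E n)) => [p||] //=; rewrite lee_fin => p1 _.
rewrite -EFinB lee_fin => pe.
by rewrite ger0_norm // subr_ge0.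
Unshelve. all: by end_near.
Qed.
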